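(* Let $0<\alpha<1$, let $n\ge 0$ be an integer, and let $p$ be an integer with $1\le p\le 2n+1$. Let $U_\alpha(m)=\Gamma(m+\alpha-1)/\Gamma(m)$ for integers $m\ge 1$ and $U_\alpha(m)=0$ for integers $m\le 0$, and let $$S_{p,2n+1}=\sum_{k=0}^{\infty}\Bigl[U_\alpha((2n+1)k+p-1)-U_\alpha((2n+1)k+p)\Bigr].$$ Then $$S_{p,2n+1}=\frac{2^{2-\alpha}\,\Gamma(\alpha)}{2n+1}(-1)^p\sum_{j=0}^{n-1}(-1)^j\Bigl(\cos\frac{\pi(2j+1)}{2(2n+1)}\Bigr)^{1-\alpha}\sin\frac{\pi(2j+1)(2p+2n-2+\alpha)}{2(2n+1)}.$$
   Context: $\Gamma$ is the Euler Gamma function. The function $U_\alpha$ is the falling factorial kernel of Caputo fractional difference maps of order $\alpha$: $U_\alpha(m)=(m+\alpha-2)^{(\alpha-1)}$ for $m\ge1$, where the falling factorial is $t^{(\beta)}=\Gamma(t+1)/\Gamma(t+1-\beta)$; in particular $U_\alpha(1)=\Gamma(\alpha)$. For a period $l\ge 1$ and $1\le p\le l$, the coefficients in the equations defining asymptotically period-$l$ points are $S_{p,l}=\sum_{k=0}^{\infty}[U_\alpha(lk+p-1)-U_\alpha(lk+p)]$; here $l=2n+1$ is odd. An empty sum equals $0$. *)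

(* Defs.v *)
(* Stdlib real numbers with Coquelicot series and improper integrals. *)
From Stdlib Require Import Reals ZArith List.
From Coquelicot Require Import Coquelicot.

Open Scope R_scope.

(* Euler's integral.  It represents the Gamma function for 0 < s only, which
   covers every use below: [U alpha m] takes Gamma at m + alpha - 1 and at m
   with m >= 1 and 0 < alpha < 1. *)
Definition Gamma (s : R) : R :=
  RInt_gen (fun t => Rpower t (s - 1) * exp (- t))
    (at_right 0) (Rbar_locally p_infty).

Definition U (alpha : R) (m : Z) : R :=
  if (1 <=? m)%Z then Gamma (IZR m + alpha - 1) / Gamma (IZR m) else 0.

(* The subtraction is in Z, so that the index 0 reached at k = 0, p = 1 is
   covered by the convention U alpha m = 0 for m <= 0. *)
Definition S_term (alpha : R) (p l k : nat) : R :=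
  U alpha (Z.of_nat l * Z.of_nat k + Z.of_nat p - 1)
  - U alpha (Z.of_nat l * Z.of_nat k + Z.of_nat p).

(* [Series] is total; its value is the sum only when [ex_series] holds. *)
Definition S_coef (alpha : R) (p l : nat) : R := Series (S_term alpha p l).

(* f 0 + ... + f (n - 1), which is 0 when n = 0 (unlike sum_f_R0 and sum_n,
   whose upper bound is included). *)
Definition sum_below (n : nat) (f : nat -> R) : R :=
  fold_right Rplus 0 (map f (seq 0 n)).

(* Main.v *)
Require Import Defs.
From Stdlib Require Import Reals ZArith List Lra Lia.
From Coquelicot Require Import Coquelicot.

(** The recurrence of Gamma gives [U alpha (m + 1) = Gamma alpha * w_m], where
    [w_m] are the coefficients of [(1 - z) ^ (- alpha)]; the differences in
    [S_term] are thus [- Gamma alpha] times the coefficients [d_m] of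
    [(1 - z) ^ (1 - alpha)], which are absolutely summable.  Their sum along an
    arithmetic progression of step [2 n + 1] is an average over the
    [2 n + 1]-st roots of unity [w] of [w ^ (- q) * (1 - w) ^ (1 - alpha)].  The
    values on the unit circle come from the ordinary differential equation
    satisfied by [r |-> sum_m d_m (r w) ^ m] on [0 <= r < 1] and Abel's theorem. *)

(** * The Gamma integral *)

Lemma filter_prod_positive_axis (P : R * R -> Prop) (x0 y0 : R) :
  0 < x0 ->
  (forall x y, 0 < x < x0 -> y0 < y -> P (x, y)) ->
  filter_prod (at_right 0) (Rbar_locally p_infty) P.
Proof.
  intros Hx0 HP.
  apply Filter_prod with (fun x => 0 < x < x0) (fun y => y0 < y).
  - exists (mkposreal x0 Hx0); intros y Hy Hy0; split; [exact Hy0|].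
    apply Rabs_lt_between' in Hy; simpl in Hy; lra.
  - exists y0; intros y Hy; exact Hy.
  - intros x y Hx Hy; apply HP; assumption.
Qed.

(** For a nonnegative integrand the integral over [[x, y]] grows with the interval, so the improper
    integral is the supremum of these values, finite by the bound [M]. *)
Lemma ex_RInt_gen_nonneg_bounded (f : R -> R) (M : R) :
  (forall t, 0 < t -> 0 <= f t) ->
  (forall t, 0 < t -> continuous f t) ->
  (forall x y, 0 < x < y -> RInt f x y <= M) ->
  ex_RInt_gen f (at_right 0) (Rbar_locally p_infty).
Proof.
  intros Hpos Hcont Hbd.
  assert (Hex : forall x y, 0 < x -> 0 < y -> ex_RInt f x y).
  { intros x y Hx Hy; apply (@ex_RInt_continuous R_CompleteNormedModule).
    intros z [Hz _]; apply Hcont.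
    apply Rlt_le_trans with (2 := Hz); apply Rmin_glb_lt; assumption. }
  destruct (completeness (fun v => exists x y, 0 < x < y /\ v = RInt f x y))
    as [l [Hub Hlub]].
  - exists M; intros v (x & y & Hxy & ->); apply Hbd; exact Hxy.
  - exists (RInt f 1 2), 1, 2; split; [lra | reflexivity].
  - exists l; intros P [eps HP].
    assert (Hnear : exists x0 y0, 0 < x0 < y0 /\ l - eps < RInt f x0 y0).
    { apply Classical_Prop.NNPP; intros Hno.
      assert (Hle : l <= l - eps).
      { apply Hlub; intros v (x & y & Hxy & ->).
        apply Rnot_lt_le; intros Hlt; apply Hno; exists x, y; split; assumption. }
      generalize (cond_pos eps); lra. }
    destruct Hnear as (x0 & y0 & Hxy0 & Hl).
    apply filter_prod_positive_axis with x0 y0; [lra|].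
    intros x y Hx Hy.
    exists (RInt f x y); split.
    + apply (@RInt_correct R_CompleteNormedModule); apply Hex; simpl; lra.
    + apply HP.
      assert (Hle : RInt f x y <= l).
      { apply Hub; exists x, y; split; [lra | reflexivity]. }
      assert (E1 : RInt f x x0 + RInt f x0 y = RInt f x y)
        by (apply (RInt_Chasles f); apply Hex; lra).
      assert (E2 : RInt f x0 y0 + RInt f y0 y = RInt f x0 y)
        by (apply (RInt_Chasles f); apply Hex; lra).
      assert (P1 : 0 <= RInt f x x0).
      { apply RInt_ge_0; [lra | apply Hex; lra | intros; apply Hpos; lra]. }
      assert (P2 : 0 <= RInt f y0 y).
      { apply RInt_ge_0; [lra | apply Hex; lra | intros; apply Hpos; lra]. }
      apply Rabs_lt_between'; generalize (cond_pos eps); lra.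
Qed.

Lemma continuous_Gamma_integrand (s t : R) :
  0 < t -> continuous (fun t => Rpower t (s - 1) * exp (- t)) t.
Proof.
  intros Ht; apply (ex_derive_continuous (fun t => Rpower t (s - 1) * exp (- t))).
  unfold Rpower; auto_derive; exact Ht.
Qed.

(* The majorant is a multiple of the derivative of [(t / (1 + t)) ^ s]. *)
Lemma Gamma_integrand_le (s t : R) :
  0 < s <= 1 -> 0 < t ->
  Rpower t (s - 1) * exp (- t) <=
    4 / s * (s * exp (s * (ln t - ln (1 + t))) * (/ t - / (1 + t))).
Proof.
  intros Hs Ht.
  (* The constant 4 comes from exp t = exp (t/2) ^ 2 >= (1 + t/2) ^ 2 >= (1 + t) ^ 2 / 4. *)
  assert (E : exp (- t) <= 4 / (1 + t) ^ 2).
  { assert (H : (1 + t / 2) ^ 2 <= exp t).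
    { replace (exp t) with (exp (t / 2) ^ 2)
        by (simpl; rewrite Rmult_1_r, <- exp_plus; f_equal; field).
      generalize (exp_ineq1_le (t / 2)); intros; apply pow_incr; lra. }
    rewrite exp_Ropp; apply Rmult_le_reg_r with (exp t * (1 + t) ^ 2).
    { apply Rmult_lt_0_compat; [apply exp_pos | apply pow_lt; lra]. }
    field_simplify; [nra | lra | apply Rgt_not_eq, exp_pos]. }
  assert (E2 : Rpower t (s - 1) = exp (s * ln t) / t).
  { unfold Rpower, Rdiv; replace ((s - 1) * ln t) with (s * ln t + - ln t) by ring.
    now rewrite exp_plus, exp_Ropp, exp_ln. }
  (* Since s <= 1 and 1 + t > 1, (1 + t) ^ s <= 1 + t. *)
  assert (E3 : exp (s * (ln t - ln (1 + t))) >= exp (s * ln t) / (1 + t)).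
  { apply Rle_ge.
    replace (exp (s * ln t) / (1 + t)) with (exp (s * ln t - ln (1 + t)))
      by (unfold Rminus, Rdiv; rewrite exp_plus, exp_Ropp, exp_ln by lra; reflexivity).
    assert (0 < ln (1 + t)) by (rewrite <- ln_1; apply ln_increasing; lra).
    destruct (Rle_lt_or_eq_dec (s * ln t - ln (1 + t)) (s * (ln t - ln (1 + t))))
      as [Hlt|Heq]; [nra | left; apply exp_increasing, Hlt | rewrite Heq; apply Rle_refl]. }
  rewrite E2.
  replace (4 / s * (s * exp (s * (ln t - ln (1 + t))) * (/ t - / (1 + t))))
    with (4 / (t * (1 + t)) * exp (s * (ln t - ln (1 + t)))) by (field; lra).
  apply Rle_trans with (4 / (t * (1 + t)) * (exp (s * ln t) / (1 + t))).
  - replace (4 / (t * (1 + t)) * (exp (s * ln t) / (1 + t)))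
      with (exp (s * ln t) / t * (4 / (1 + t) ^ 2)) by (field; lra).
    apply Rmult_le_compat_l; [|exact E].
    apply Rlt_le, Rdiv_lt_0_compat; [apply exp_pos | exact Ht].
  - apply Rmult_le_compat_l; [|apply Rge_le, E3].
    apply Rlt_le, Rdiv_lt_0_compat; nra.
Qed.

(** The majorant has the primitive 4/s * (t / (1 + t)) ^ s, whose values lie between 0 and 4/s.
    Arguments above 1 are reached by integer shifts in [ex_Gamma_integral_shift]. *)
Lemma ex_Gamma_integral (s : R) :
  0 < s <= 1 ->
  ex_RInt_gen (fun t => Rpower t (s - 1) * exp (- t))
    (at_right 0) (Rbar_locally p_infty).
Proof.
  intros Hs; apply ex_RInt_gen_nonneg_bounded with (4 / s).
  - intros t Ht; apply Rmult_le_pos; apply Rlt_le, exp_pos.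
  - intros t Ht; apply continuous_Gamma_integrand, Ht.
  - intros x y Hxy.
    pose (g := fun t => exp (s * (ln t - ln (1 + t)))).
    pose (dg := fun t => s * exp (s * (ln t - ln (1 + t))) * (/ t - / (1 + t))).
    assert (Hg : is_RInt dg x y (g y - g x)).
    { apply (is_RInt_derive g dg); rewrite Rmin_left, Rmax_right by lra; intros t Ht.
      - unfold g, dg, Rminus; auto_derive; [lra | field; lra].
      - apply (ex_derive_continuous dg); unfold dg; auto_derive; repeat split; lra. }
    assert (H : RInt (fun t => Rpower t (s - 1) * exp (- t)) x y
                <= RInt (fun t => 4 / s * dg t) x y).
    { apply RInt_le.
      - lra.
      - apply (@ex_RInt_continuous R_CompleteNormedModule).
        rewrite Rmin_left, Rmax_right by lra; intros z Hz.
        apply continuous_Gamma_integrand; lra.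
      - exists (4 / s * (g y - g x)).
        apply (is_RInt_scal dg x y (4 / s) (g y - g x)), Hg.
      - intros t Ht; apply Gamma_integrand_le; lra. }
    rewrite (is_RInt_unique (fun t => 4 / s * dg t) x y (4 / s * (g y - g x))) in H
      by apply (is_RInt_scal dg x y (4 / s) (g y - g x)), Hg.
    apply Rle_trans with (1 := H).
    rewrite <- (Rmult_1_r (4 / s)) at 2.
    apply Rmult_le_compat_l; [apply Rlt_le, Rdiv_lt_0_compat; lra|].
    assert (g y <= 1).
    { unfold g; apply Rle_trans with (exp 0); [left; apply exp_increasing | rewrite exp_0; lra].
      assert (ln y < ln (1 + y)) by (apply ln_increasing; lra).
      assert (0 < s * (ln (1 + y) - ln y)) by (apply Rmult_lt_0_compat; lra); lra. }
    assert (0 < g x) by apply exp_pos.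
    lra.
Qed.

(** Integration by parts: the boundary function t ^ s * exp (- t) tends to 0 at both ends.
    Convergence of the shifted integral is a result here, obtained from that of the original one. *)
Lemma is_RInt_gen_Gamma_succ (s l : R) :
  0 < s ->
  is_RInt_gen (fun t => Rpower t (s - 1) * exp (- t))
    (at_right 0) (Rbar_locally p_infty) l ->
  is_RInt_gen (fun t => Rpower t (s + 1 - 1) * exp (- t))
    (at_right 0) (Rbar_locally p_infty) (s * l).
Proof.
  intros Hs Hl.
  (* In this form both boundary limits reduce to an exponent tending to minus infinity. *)
  pose (F := fun t => exp (s * ln t - t)).
  assert (HF : forall t, 0 < t ->
    is_derive F t (s * (Rpower t (s - 1) * exp (- t))
                   - Rpower t (s + 1 - 1) * exp (- t))).
  { intros t Ht; unfold F; auto_derive; [exact Ht|].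
    replace (s + 1 - 1) with ((s - 1) + 1) by ring.
    rewrite Rpower_plus, Rpower_1 by exact Ht; unfold Rpower.
    replace (s * ln t + - t) with ((s - 1) * ln t + ln t + - t) by ring.
    rewrite !exp_plus, exp_ln by exact Ht; field; lra. }
  assert (HD : forall t, 0 < t ->
    Derive F t = s * (Rpower t (s - 1) * exp (- t)) - Rpower t (s + 1 - 1) * exp (- t)).
  { intros t Ht; apply is_derive_unique, HF, Ht. }
  assert (Hdom : filter_prod (at_right 0) (Rbar_locally p_infty)
     (fun ab : R * R => 0 < Rmin (fst ab) (snd ab))).
  { apply filter_prod_positive_axis with 1 1; [lra|].
    intros x y Hx Hy; simpl; apply Rmin_glb_lt; lra. }
  assert (H0 : is_RInt_gen (Derive F) (at_right 0) (Rbar_locally p_infty) (0 - 0)).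
  { apply is_RInt_gen_Derive.
    - eapply filter_imp; [|exact Hdom]; intros [x y] H t Ht; simpl in *.
      eexists; apply HF; lra.
    - eapply filter_imp; [|exact Hdom]; intros [x y] H t Ht; simpl in *.
      apply continuous_ext_loc with
        (fun t => s * (Rpower t (s - 1) * exp (- t)) - Rpower t (s + 1 - 1) * exp (- t)).
      + assert (Ht0 : 0 < t) by lra.
        exists (mkposreal t Ht0); intros u Hu; symmetry; apply HD.
        apply Rabs_lt_between' in Hu; simpl in Hu; lra.
      + apply (continuous_minus
          (fun t => s * (Rpower t (s - 1) * exp (- t)))
          (fun t => Rpower t (s + 1 - 1) * exp (- t))).
        * apply (continuous_scal_r s (fun t => Rpower t (s - 1) * exp (- t))).
          apply continuous_Gamma_integrand; lra.
        * apply continuous_Gamma_integrand; lra.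
    - apply (filterlim_comp _ _ _ (fun t => s * ln t - t) exp _ (Rbar_locally m_infty));
        [|apply is_lim_exp_m].
      intros P [M HM].
      assert (HA : Rbar_locally m_infty (fun y => y < M / s)) by (exists (M / s); tauto).
      generalize (is_lim_ln_0 _ HA); intros [d Hd]; exists d; intros t Ht Ht0.
      apply HM; specialize (Hd t Ht Ht0).
      apply Rmult_lt_compat_l with (1 := Hs) in Hd.
      replace (s * (M / s)) with M in Hd by (field; lra); lra.
    - apply (filterlim_comp _ _ _ (fun t => s * ln t - t) exp _ (Rbar_locally m_infty));
        [|apply is_lim_exp_m].
      intros P [M HM].
      (* Once ln t / t < 1 / (2 s), the exponent s ln t - t is below - t / 2, hence below [M] for t
         > - 2 M. *)
      assert (HA : locally 0 (fun y => y < / (2 * s))).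
      { apply (open_lt (/ (2 * s))); apply Rinv_0_lt_compat; lra. }
      generalize (is_lim_div_ln_p _ HA); intros [T HT].
      exists (Rmax T (Rmax 0 (- 2 * M))); intros t Ht.
      generalize (Rmax_l T (Rmax 0 (- 2 * M))) (Rmax_r T (Rmax 0 (- 2 * M)))
        (Rmax_l 0 (- 2 * M)) (Rmax_r 0 (- 2 * M)); intros.
      apply HM; assert (Ht' : T < t) by lra; specialize (HT t Ht').
      assert (Ht0 : 0 < t) by lra.
      apply Rmult_lt_compat_r with (r := s * t) in HT; [|nra].
      replace (ln t / t * (s * t)) with (s * ln t) in HT by (field; lra).
      replace (/ (2 * s) * (s * t)) with (t / 2) in HT by (field; lra); lra. }
  replace (s * l) with (minus (scal s l) (0 - 0)) by (unfold minus, plus, opp, scal; simpl; unfold mult; simpl; ring).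
  apply is_RInt_gen_ext with
    (fun t => minus (scal s (Rpower t (s - 1) * exp (- t))) (Derive F t)).
  - eapply filter_imp; [|exact Hdom]; intros [x y] H t Ht; simpl in *.
    rewrite HD by lra; unfold minus, plus, opp, scal; simpl; unfold mult; simpl; ring.
  - apply (is_RInt_gen_minus (fun t => scal s (Rpower t (s - 1) * exp (- t))) (Derive F));
      [|exact H0].
    apply (is_RInt_gen_scal (fun t => Rpower t (s - 1) * exp (- t)) s l), Hl.
Qed.

Lemma Gamma_unique (s l : R) :
  is_RInt_gen (fun t => Rpower t (s - 1) * exp (- t))
    (at_right 0) (Rbar_locally p_infty) l ->
  Gamma s = l.
Proof.
  intros H; unfold Gamma.
  exact (is_RInt_gen_unique (fun t => Rpower t (s - 1) * exp (- t)) l H).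
Qed.

(** [Gamma] is a total operator, so the functional equation can only be read off from convergence;
    the two are proved in one induction, each step feeding the next. *)
Lemma ex_Gamma_integral_shift (s : R) (m : nat) :
  0 < s <= 1 ->
  is_RInt_gen (fun t => Rpower t (s + INR m - 1) * exp (- t))
    (at_right 0) (Rbar_locally p_infty) (Gamma (s + INR m)) /\
  Gamma (s + INR (S m)) = (s + INR m) * Gamma (s + INR m).
Proof.
  intros Hs; induction m as [|m [IH1 IH2]].
  - assert (H : is_RInt_gen (fun t => Rpower t (s + INR 0 - 1) * exp (- t))
      (at_right 0) (Rbar_locally p_infty) (Gamma (s + INR 0))).
    { apply (RInt_gen_correct (fun t => Rpower t (s + INR 0 - 1) * exp (- t))).
      simpl; rewrite Rplus_0_r; apply ex_Gamma_integral, Hs. }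
    split; [exact H|].
    apply Gamma_unique; simpl in *; rewrite Rplus_0_r in *.
    apply is_RInt_gen_Gamma_succ; [lra | exact H].
  - assert (Hp : 0 < s + INR m) by (generalize (pos_INR m); lra).
    assert (H : is_RInt_gen (fun t => Rpower t (s + INR (S m) - 1) * exp (- t))
      (at_right 0) (Rbar_locally p_infty) (Gamma (s + INR (S m)))).
    { rewrite IH2.
      replace (s + INR (S m)) with (s + INR m + 1) by (rewrite S_INR; ring).
      apply is_RInt_gen_Gamma_succ; [exact Hp | exact IH1]. }
    split; [exact H|].
    apply Gamma_unique.
    replace (s + INR (S (S m))) with (s + INR (S m) + 1) by (rewrite (S_INR (S m)); ring).
    apply is_RInt_gen_Gamma_succ; [rewrite S_INR; lra | exact H].
Qed.

Lemma Gamma_shift_succ (s : R) (m : nat) :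
  0 < s <= 1 -> Gamma (s + INR (S m)) = (s + INR m) * Gamma (s + INR m).
Proof. intros Hs; apply ex_Gamma_integral_shift, Hs. Qed.

Lemma Gamma_1 : Gamma 1 = 1.
Proof.
  apply Gamma_unique.
  pose (F := fun t => - exp (- t)).
  assert (HF : forall t, is_derive F t (exp (- t))).
  { intros t; unfold F; auto_derive; [exact I | ring]. }
  assert (HD : forall t, Derive F t = exp (- t)).
  { intros t; apply is_derive_unique, HF. }
  apply is_RInt_gen_ext with (Derive F).
  - apply filter_forall; intros ab t _; rewrite HD.
    unfold Rpower; replace ((1 - 1) * ln t) with 0 by ring; rewrite exp_0, Rmult_1_l; reflexivity.
  - replace (1 : R) with (0 - F 0) by (unfold F; rewrite Ropp_0, exp_0; ring).
    apply is_RInt_gen_Derive.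
    + apply filter_forall; intros ab t _; eexists; apply HF.
    + apply filter_forall; intros ab t _.
      apply continuous_ext with (fun t => exp (- t)); [intros u; symmetry; apply HD|].
      apply (ex_derive_continuous (fun t => exp (- t))); auto_derive; exact I.
    + apply (filterlim_filter_le_1 (F := locally 0) F (filter_le_within (F := locally 0) _)).
      apply (ex_derive_continuous F); eexists; apply HF.
    + apply (filterlim_comp _ _ _ (fun t => exp (- t)) Ropp _ (Rbar_locally (Finite 0))).
      * apply (filterlim_comp _ _ _ Ropp exp _ (Rbar_locally m_infty)); [|apply is_lim_exp_m].
        intros P [M HM]; exists (- M); intros t Ht; apply HM; lra.
      * generalize (filterlim_opp (K := R_AbsRing) (V := R_NormedModule) 0).
        unfold opp; simpl; rewrite Ropp_0; intros H; exact H.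
Qed.

(** * Binomial coefficients *)

(* Coefficients of [(1 - z) ^ (- alpha)]. *)
Fixpoint neg_power_coef (alpha : R) (m : nat) : R :=
  match m with
  | O => 1
  | S k => neg_power_coef alpha k * ((INR k + alpha) / (INR k + 1))
  end.

(* Coefficients of [(1 - z) ^ (1 - alpha) = (1 - z) * (1 - z) ^ (- alpha)]. *)
Definition power_coef (alpha : R) (m : nat) : R :=
  match m with
  | O => 1
  | S k => neg_power_coef alpha (S k) - neg_power_coef alpha k
  end.

Lemma neg_power_coef_pos (alpha : R) (m : nat) :
  0 < alpha -> 0 < neg_power_coef alpha m.
Proof.
  intros Ha; induction m as [|m IH]; [simpl; lra|].
  change (0 < neg_power_coef alpha m * ((INR m + alpha) / (INR m + 1))).
  generalize (pos_INR m); intros Hm.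
  apply Rmult_lt_0_compat; [exact IH | apply Rdiv_lt_0_compat; lra].
Qed.

(** This form shows the sign: for 0 < alpha < 1 every coefficient after the first is negative. *)
Lemma power_coef_S (alpha : R) (k : nat) :
  power_coef alpha (S k) = - ((1 - alpha) * neg_power_coef alpha k / (INR k + 1)).
Proof.
  simpl; generalize (pos_INR k); intros; field; lra.
Qed.

(** Coefficientwise form of F' = z F' - (1 - alpha) F, the equation of (1 - z) ^ (1 - alpha). *)
Lemma power_coef_rec (alpha : R) (m : nat) :
  INR (S m) * power_coef alpha (S m) = (INR m - (1 - alpha)) * power_coef alpha m.
Proof.
  rewrite power_coef_S, S_INR; generalize (pos_INR m); intros Hm.
  destruct m as [|m]; [simpl; field|].
  rewrite power_coef_S, S_INR in *; simpl neg_power_coef.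
  generalize (pos_INR m); intros; field; lra.
Qed.

Lemma sum_n_power_coef (alpha : R) (m : nat) :
  sum_n (power_coef alpha) m = neg_power_coef alpha m.
Proof.
  induction m as [|m IH]; [now rewrite sum_O|].
  rewrite sum_Sn, IH; unfold plus; simpl; ring.
Qed.

(** The bound is (m + 1) ^ (alpha - 1). The step factor 1 - (1 - alpha) / (m + 1) is at most 1 - (1
    - alpha) ln ((m + 2) / (m + 1)), hence at most ((m + 2) / (m + 1)) ^ (alpha - 1). *)
Lemma neg_power_coef_le (alpha : R) (m : nat) :
  0 < alpha < 1 -> neg_power_coef alpha m <= exp (- (1 - alpha) * ln (INR m + 1)).
Proof.
  intros Ha; induction m as [|m IH].
  - simpl; rewrite Rplus_0_l, ln_1, Rmult_0_r, exp_0; lra.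
  - change (neg_power_coef alpha (S m))
      with (neg_power_coef alpha m * ((INR m + alpha) / (INR m + 1))).
    generalize (pos_INR m); intros Hm; rewrite S_INR.
    replace (- (1 - alpha) * ln (INR m + 1 + 1)) with
      (- (1 - alpha) * ln (INR m + 1)
       + - (1 - alpha) * (ln (INR m + 1 + 1) - ln (INR m + 1))) by ring.
    rewrite exp_plus; apply Rmult_le_compat.
    + apply Rlt_le, neg_power_coef_pos; lra.
    + apply Rlt_le, Rdiv_lt_0_compat; lra.
    + exact IH.
    + eapply Rle_trans; [|apply exp_ineq1_le].
      assert (L : ln (INR m + 1 + 1) - ln (INR m + 1) <= / (INR m + 1)).
      { rewrite <- (ln_exp (/ (INR m + 1))).
        assert (H : ln (INR m + 1 + 1) <= ln (exp (/ (INR m + 1)) * (INR m + 1))).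
        { apply ln_le; [lra|].
          apply Rle_trans with ((1 + / (INR m + 1)) * (INR m + 1)).
          - right; field; lra.
          - apply Rmult_le_compat_r; [lra | apply exp_ineq1_le]. }
        rewrite ln_mult in H by (try apply exp_pos; lra); lra. }
      apply Rmult_le_compat_l with (r := 1 - alpha) in L; [|lra].
      replace ((INR m + alpha) / (INR m + 1)) with (1 - (1 - alpha) * / (INR m + 1))
        by (field; lra).
      lra.
Qed.

Lemma is_lim_seq_neg_power_coef (alpha : R) :
  0 < alpha < 1 -> is_lim_seq (neg_power_coef alpha) 0.
Proof.
  intros Ha.
  apply is_lim_seq_le_le with (fun _ => 0) (fun m => exp (- (1 - alpha) * ln (INR m + 1))).
  - intros m; split; [apply Rlt_le, neg_power_coef_pos; lra | apply neg_power_coef_le, Ha].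
  - apply is_lim_seq_const.
  - apply (filterlim_comp _ _ _ (fun m => - (1 - alpha) * ln (INR m + 1)) exp _
      (Rbar_locally m_infty)); [|exact is_lim_exp_m].
    apply (filterlim_comp _ _ _ (fun m => INR m + 1) (fun x => - (1 - alpha) * ln x) _
      (Rbar_locally p_infty)).
    + apply (is_lim_seq_ext (fun m => INR (S m))); [intros; apply S_INR|].
      apply -> is_lim_seq_incr_1; apply is_lim_seq_INR.
    + intros P [M HM].
      assert (HA : Rbar_locally p_infty (fun y => - M / (1 - alpha) < y))
        by (exists (- M / (1 - alpha)); tauto).
      generalize (is_lim_ln_p _ HA); intros [T HT]; exists T; intros x Hx.
      apply HM; specialize (HT x Hx).
      apply Rmult_lt_compat_l with (r := 1 - alpha) in HT; [|lra].
      replace ((1 - alpha) * (- M / (1 - alpha))) with (- M) in HT by (field; lra); lra.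
Qed.

(** The partial sums telescope to [neg_power_coef], which tends to 0. The sum is the value of (1 -
    z) ^ (1 - alpha) at z = 1, the contribution of the trivial root of unity. *)
Lemma is_series_power_coef (alpha : R) :
  0 < alpha < 1 -> is_series (power_coef alpha) 0.
Proof.
  intros Ha; apply (filterlim_ext (neg_power_coef alpha)).
  - intros m; symmetry; apply sum_n_power_coef.
  - exact (is_lim_seq_neg_power_coef alpha Ha).
Qed.

(** All terms after the first have the same sign, so convergence is already absolute. *)
Lemma ex_series_Rabs_power_coef (alpha : R) :
  0 < alpha < 1 -> ex_series (fun m => Rabs (power_coef alpha m)).
Proof.
  intros Ha; apply ex_series_incr_1.
  apply (ex_series_ext (fun m => opp (power_coef alpha (S m)))).
  - intros m; rewrite power_coef_S, Rabs_Ropp; unfold opp; simpl.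
    rewrite Rabs_pos_eq; [ring|].
    assert (0 < neg_power_coef alpha m) by (apply neg_power_coef_pos; lra).
    generalize (pos_INR m); intros Hm.
    apply Rlt_le, Rdiv_lt_0_compat; [apply Rmult_lt_0_compat|]; lra.
  - apply (ex_series_opp (fun m => power_coef alpha (S m))).
    apply -> (ex_series_incr_1 (power_coef alpha)).
    exists 0; apply is_series_power_coef, Ha.
Qed.

(** Each step multiplies both sides by (alpha + k) / (1 + k). Positivity of the denominator is
    carried along to justify the division. *)
Lemma Gamma_quotient (alpha : R) (k : nat) :
  0 < alpha < 1 ->
  0 < Gamma (1 + INR k) /\
  Gamma (alpha + INR k) / Gamma (1 + INR k) = Gamma alpha * neg_power_coef alpha k.
Proof.
  intros Ha; induction k as [|k [IH1 IH2]].
  - simpl; rewrite !Rplus_0_r, Gamma_1; split; [lra | field].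
  - rewrite !Gamma_shift_succ by lra; generalize (pos_INR k); intros Hk; split.
    + apply Rmult_lt_0_compat; lra.
    + simpl neg_power_coef; rewrite <- Rmult_assoc, <- IH2; field; lra.
Qed.

Lemma U_succ (alpha : R) (k : nat) :
  0 < alpha < 1 -> U alpha (Z.of_nat k + 1) = Gamma alpha * neg_power_coef alpha k.
Proof.
  intros Ha; unfold U.
  replace (1 <=? Z.of_nat k + 1)%Z with true by (symmetry; apply Z.leb_le; lia).
  rewrite plus_IZR, <- INR_IZR_INZ, <- (proj2 (Gamma_quotient alpha k Ha)).
  f_equal; f_equal; ring.
Qed.

Lemma S_term_power_coef (alpha : R) (p l k : nat) :
  0 < alpha < 1 -> (1 <= p)%nat ->
  S_term alpha p l k = - Gamma alpha * power_coef alpha (l * k + (p - 1)).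
Proof.
  intros Ha Hp; unfold S_term.
  rewrite <- Nat2Z.inj_mul, <- Nat2Z.inj_add.
  replace (l * k + p)%nat with (S (l * k + (p - 1))) by lia.
  rewrite Nat2Z.inj_succ, <- Z.add_1_r, U_succ, Z.add_simpl_r by exact Ha.
  (* At index 0 the convention [U alpha 0 = 0] leaves - [Gamma alpha], in agreement with
     [power_coef alpha 0 = 1]. *)
  destruct (l * k + (p - 1))%nat as [|m].
  - simpl; unfold U; simpl; ring.
  - rewrite Nat2Z.inj_succ, <- Z.add_1_r, U_succ by exact Ha; unfold power_coef; ring.
Qed.

(** * The binomial series on the unit circle *)

Lemma CV_radius_ge_1 (a : nat -> R) :
  ex_series (fun m => Rabs (a m)) -> Rbar_le 1 (CV_radius a).
Proof.
  intros Ha; unfold CV_radius; apply (proj1 (Lub_Rbar_correct (CV_disk a))).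
  apply (ex_series_ext (fun m => Rabs (a m))); [|exact Ha].
  intros m; now rewrite pow1, Rmult_1_r.
Qed.

Lemma PSeries_at_1 (a : nat -> R) : PSeries a 1 = Series a.
Proof. apply Series_ext; intros m; now rewrite pow1, Rmult_1_r. Qed.

(** [Abel] speaks of the radius of convergence itself, so it settles the case of radius 1; if the
    radius is larger, 1 is an interior point and continuity suffices. *)
Lemma filterlim_PSeries_left_1 (a : nat -> R) :
  ex_series (fun m => Rabs (a m)) ->
  filterlim (PSeries a) (at_left 1) (locally (Series a)).
Proof.
  intros Ha; rewrite <- PSeries_at_1.
  destruct (Rbar_le_lt_or_eq_dec _ _ (CV_radius_ge_1 a Ha)) as [Hlt|Heq].
  - apply (filterlim_filter_le_1 (F := locally 1) (PSeries a)
      (filter_le_within (F := locally 1) _)).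
    apply continuity_pt_filterlim, PSeries_continuity; now rewrite Rabs_R1.
  - generalize (Abel a); rewrite <- Heq; simpl; intros H; apply H.
    + lra.
    + exact I.
    + apply CV_disk_correct.
      apply (ex_series_ext (fun m => Rabs (a m))); [|exact Ha].
      intros m; now rewrite pow1, Rmult_1_r.
Qed.

Lemma ex_series_Rabs_power_coef_mult (alpha : R) (f : nat -> R) :
  0 < alpha < 1 -> (forall m, Rabs (f m) <= 1) ->
  ex_series (fun m => Rabs (power_coef alpha m * f m)).
Proof.
  intros Ha Hf.
  apply (ex_series_le (K := R_AbsRing) (V := R_CompleteNormedModule)
    _ (fun m => Rabs (power_coef alpha m))); [|apply ex_series_Rabs_power_coef, Ha].
  intros m; unfold norm; simpl; unfold abs; simpl.
  rewrite Rabs_Rabsolu, Rabs_mult; generalize (Hf m) (Rabs_pos (power_coef alpha m)); nra.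
Qed.

Section BinomialSeries.

Variables (alpha theta : R).
Hypothesis (Halpha : 0 < alpha < 1).

Let beta := 1 - alpha.
Let a (m : nat) := power_coef alpha m * cos (INR m * theta).
Let b (m : nat) := power_coef alpha m * sin (INR m * theta).

Let Ha : ex_series (fun m => Rabs (a m)).
Proof.
  apply ex_series_Rabs_power_coef_mult; [exact Halpha|].
  intros m; apply Rabs_le, COS_bound.
Qed.

Let Hb : ex_series (fun m => Rabs (b m)).
Proof.
  apply ex_series_Rabs_power_coef_mult; [exact Halpha|].
  intros m; apply Rabs_le, SIN_bound.
Qed.

Let in_disk (u : nat -> R) (r : R) :
  ex_series (fun m => Rabs (u m)) -> Rabs r < 1 -> Rbar_lt (Rabs r) (CV_radius u).
Proof.
  intros Hu Hr; apply Rbar_lt_le_trans with 1; [exact Hr | apply CV_radius_ge_1, Hu].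
Qed.

(** Passes from a recurrence on coefficients to an identity of sums. The weights [x] and [y] are
    free so that the real and the imaginary equation are both instances. *)
Let PSeries_derive_combination (u v w : nat -> R) (x y r : R) :
  ex_series (fun m => Rabs (u m)) -> ex_series (fun m => Rabs (v m)) -> Rabs r < 1 ->
  (forall m, PS_derive w m =
     x * (INR m * u m - beta * u m) + y * (INR m * v m - beta * v m)) ->
  PSeries (PS_derive w) r =
    x * (r * PSeries (PS_derive u) r - beta * PSeries u r)
    + y * (r * PSeries (PS_derive v) r - beta * PSeries v r).
Proof.
  intros Hu Hv Hr Hrec.
  assert (E : forall z, ex_series (fun m => Rabs (z m)) ->
    ex_pseries (PS_incr_1 (PS_derive z)) r /\ ex_pseries (PS_scal beta z) r).
  { intros z Hz; split.
    - apply ex_pseries_incr_1, ex_pseries_derive, in_disk; assumption.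
    - apply ex_pseries_scal; [apply Rmult_comm|].
      apply CV_radius_inside, in_disk; assumption. }
  destruct (E u Hu) as [Eu1 Eu2]; destruct (E v Hv) as [Ev1 Ev2].
  rewrite <- !PSeries_incr_1, <- !PSeries_scal, <- !PSeries_minus by assumption.
  rewrite <- !PSeries_scal, <- PSeries_plus
    by (apply ex_pseries_scal; [apply Rmult_comm | apply ex_pseries_minus; assumption]).
  apply PSeries_ext; intros m; rewrite Hrec.
  (* These are the coefficients of r Z'(r); at m = 0 both sides are 0. *)
  assert (D : forall z : nat -> R, PS_incr_1 (PS_derive z) m = INR m * z m).
  { intros z; destruct m; simpl; [unfold zero; simpl; ring | reflexivity]. }
  unfold PS_plus, PS_scal, PS_minus, PS_plus, PS_opp.
  unfold plus, scal, opp; simpl; unfold mult; simpl; rewrite !D; ring.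
Qed.

(* The real and imaginary parts of [(1 - r w) F' = - beta w F], where
   [F r = sum_m c_m (r w) ^ m] and [w = exp (i theta)]. *)
Let binomial_ode (r : R) : Rabs r < 1 ->
  PSeries (PS_derive a) r =
    cos theta * (r * PSeries (PS_derive a) r - beta * PSeries a r)
    - sin theta * (r * PSeries (PS_derive b) r - beta * PSeries b r) /\
  PSeries (PS_derive b) r =
    sin theta * (r * PSeries (PS_derive a) r - beta * PSeries a r)
    + cos theta * (r * PSeries (PS_derive b) r - beta * PSeries b r).
Proof.
  intros Hr; split.
  - unfold Rminus at 1; rewrite Ropp_mult_distr_l.
    apply (PSeries_derive_combination a b a (cos theta) (- sin theta)); try assumption.
    intros m; unfold PS_derive, a, b, beta; rewrite <- Rmult_assoc, power_coef_rec, S_INR.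
    replace ((INR m + 1) * theta) with (INR m * theta + theta) by ring.
    rewrite cos_plus; ring.
  - apply (PSeries_derive_combination a b b (sin theta) (cos theta)); try assumption.
    intros m; unfold PS_derive, a, b, beta; rewrite <- Rmult_assoc, power_coef_rec, S_INR.
    replace ((INR m + 1) * theta) with (INR m * theta + theta) by ring.
    rewrite sin_plus; ring.
Qed.

(** [sqmod r] and [arg r] are the squared modulus and the principal argument of 1 - r w, with w =
    exp (i theta). The arctangent gives the argument because the real part is positive
    ([re_pos]). *)
Let sqmod (r : R) := 1 - 2 * r * cos theta + r ^ 2.
Let arg (r : R) := atan (- (r * sin theta) / (1 - r * cos theta)).

Let re_pos (r : R) : Rabs r < 1 -> 0 < 1 - r * cos theta.
Proof.
  intros Hr; generalize (Rle_abs (r * cos theta)) (Rabs_le (cos theta) 1 (COS_bound theta)).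
  rewrite Rabs_mult; intros H1 H2.
  apply Rmult_le_compat_l with (r := Rabs r) in H2; [lra | apply Rabs_pos].
Qed.

Let sqmod_sum (r : R) : sqmod r = (1 - r * cos theta) ^ 2 + (r * sin theta) ^ 2.
Proof.
  unfold sqmod; generalize (sin2_cos2 theta); unfold Rsqr; intros H.
  replace ((1 - r * cos theta) ^ 2 + (r * sin theta) ^ 2)
    with (1 - 2 * r * cos theta + r ^ 2 * (sin theta * sin theta + cos theta * cos theta))
    by ring.
  rewrite H; ring.
Qed.

Let sqmod_pos (r : R) : Rabs r < 1 -> 0 < sqmod r.
Proof.
  intros Hr; rewrite sqmod_sum; generalize (re_pos r Hr); intros.
  generalize (pow2_ge_0 (r * sin theta)); nra.
Qed.

(** Uniqueness for a linear differential equation: the quotient of the series by the claimed closed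
    form has zero derivative on [0, r] and equals 1 at 0. *)
Let PSeries_binomial (r : R) : 0 < r < 1 ->
  PSeries a r = exp (beta / 2 * ln (sqmod r)) * cos (beta * arg r) /\
  PSeries b r = exp (beta / 2 * ln (sqmod r)) * sin (beta * arg r).
Proof.
  intros Hr.
  pose (L := fun t => ln (sqmod t)).
  assert (HL : forall t, Rabs t < 1 -> is_derive L t (2 * (t - cos theta) / sqmod t)).
  { intros t Ht; generalize (sqmod_pos t Ht); intros Hs.
    unfold L, sqmod; auto_derive; fold (sqmod t); unfold sqmod in *; [lra | field; lra]. }
  assert (Harg : forall t, Rabs t < 1 -> is_derive arg t (- sin theta / sqmod t)).
  { intros t Ht; generalize (re_pos t Ht) (sqmod_pos t Ht); rewrite sqmod_sum; intros Hp Hs.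
    unfold arg; auto_derive; [lra|]; field; lra. }
  pose (A := PSeries a); pose (B := PSeries b).
  (* [binomial_ode] is a linear system in the two derivatives. It is solved by multiplying with the
     conjugate of 1 - t w, which makes [sqmod t] the determinant. *)
  assert (HA : forall t, Rabs t < 1 ->
    is_derive A t (beta * ((t - cos theta) * A t + sin theta * B t) / sqmod t) /\
    is_derive B t (beta * ((t - cos theta) * B t - sin theta * A t) / sqmod t)).
  { intros t Ht; destruct (binomial_ode t Ht) as [E1 E2].
    generalize (is_derive_PSeries a t (in_disk a t Ha Ht))
      (is_derive_PSeries b t (in_disk b t Hb Ht)).
    generalize (sqmod_pos t Ht); fold A B in E1, E2 |- *.
    generalize (sin2_cos2 theta); unfold Rsqr; intros Hsc Hs DA DB.
    set (dA := PSeries (PS_derive a) t) in *; set (dB := PSeries (PS_derive b) t) in *.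
    set (c := cos theta) in *; set (s := sin theta) in *.
    assert (F1 : (1 - t * c) * dA + t * s * dB = - beta * (c * A t - s * B t)) by lra.
    assert (F2 : (1 - t * c) * dB - t * s * dA = - beta * (s * A t + c * B t)) by lra.
    split.
    - replace (beta * ((t - c) * A t + s * B t) / sqmod t) with dA;
        [exact DA|].
      apply Rmult_eq_reg_r with (sqmod t); [|lra].
      unfold Rdiv; rewrite Rmult_assoc, Rinv_l, Rmult_1_r, sqmod_sum by lra; fold c s.
      transitivity ((1 - t * c) * ((1 - t * c) * dA + t * s * dB)
                    - t * s * ((1 - t * c) * dB - t * s * dA)); [ring|].
      rewrite F1, F2.
      transitivity (beta * ((t * (s * s + c * c) - c) * A t + s * B t)); [ring|].
      rewrite Hsc; ring.
    - replace (beta * ((t - c) * B t - s * A t) / sqmod t) with dB;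
        [exact DB|].
      apply Rmult_eq_reg_r with (sqmod t); [|lra].
      unfold Rdiv; rewrite Rmult_assoc, Rinv_l, Rmult_1_r, sqmod_sum by lra; fold c s.
      transitivity ((1 - t * c) * ((1 - t * c) * dB - t * s * dA)
                    + t * s * ((1 - t * c) * dA + t * s * dB)); [ring|].
      rewrite F1, F2.
      transitivity (beta * ((t * (s * s + c * c) - c) * B t - s * A t)); [ring|].
      rewrite Hsc; ring. }
  (* [h1 + i h2] is [F r] divided by [(1 - r w) ^ beta]. *)
  pose (h1 := fun t => exp (- (beta / 2) * L t)
                       * (A t * cos (beta * arg t) + B t * sin (beta * arg t))).
  pose (h2 := fun t => exp (- (beta / 2) * L t)
                       * (B t * cos (beta * arg t) - A t * sin (beta * arg t))).
  assert (Hin : forall t, 0 <= t <= r -> Rabs t < 1)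
    by (intros t Ht; apply Rabs_def1; lra).
  (* Matches the eta-expanded [Derive] terms that [auto_derive] produces. *)
  assert (DU : forall (f : R -> R) (x l : R),
    is_derive f x l -> Derive (fun y : R => f y) x = l)
    by (intros f x l; apply is_derive_unique).
  assert (E1 : h1 0 = h1 r).
  { apply (eq_is_derive h1 0 r); [|lra]; intros t Ht; apply Hin in Ht.
    destruct (HA t Ht) as [DA DB]; generalize (HL t Ht) (Harg t Ht) (sqmod_pos t Ht).
    intros DL Dg Hs; unfold h1; auto_derive.
    - repeat split; eexists; eassumption.
    - rewrite !Rmult_1_l, (DU _ _ _ DA), (DU _ _ _ DB), (DU _ _ _ DL), (DU _ _ _ Dg).
      unfold zero; simpl; field; lra. }
  assert (E2 : h2 0 = h2 r).
  { apply (eq_is_derive h2 0 r); [|lra]; intros t Ht; apply Hin in Ht.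
    destruct (HA t Ht) as [DA DB]; generalize (HL t Ht) (Harg t Ht) (sqmod_pos t Ht).
    intros DL Dg Hs; unfold h2; auto_derive.
    - repeat split; eexists; eassumption.
    - rewrite !Rmult_1_l, (DU _ _ _ DA), (DU _ _ _ DB), (DU _ _ _ DL), (DU _ _ _ Dg).
      unfold zero; simpl; field; lra. }
  assert (A0 : A 0 = 1).
  { unfold A; rewrite PSeries_0; unfold a; simpl; rewrite Rmult_0_l, cos_0; ring. }
  assert (B0 : B 0 = 0).
  { unfold B; rewrite PSeries_0; unfold b; simpl; rewrite Rmult_0_l, sin_0; ring. }
  assert (L0 : L 0 = 0).
  { unfold L, sqmod; replace (1 - 2 * 0 * cos theta + 0 ^ 2) with 1 by ring; apply ln_1. }
  assert (G0 : arg 0 = 0).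
  { unfold arg; replace (- (0 * sin theta) / (1 - 0 * cos theta)) with 0 by field.
    apply atan_0. }
  unfold h1 in E1; unfold h2 in E2.
  rewrite A0, B0, L0, G0, !Rmult_0_r, exp_0, cos_0, sin_0 in E1, E2.
  fold (A r) (B r); change (ln (sqmod r)) with (L r).
  assert (Ee : exp (beta / 2 * L r) * exp (- (beta / 2) * L r) = 1).
  { rewrite <- exp_plus; replace (beta / 2 * L r + - (beta / 2) * L r) with 0 by ring.
    apply exp_0. }
  generalize (sin2_cos2 (beta * arg r)); unfold Rsqr; intros Hsc.
  set (C := cos (beta * arg r)) in *; set (S := sin (beta * arg r)) in *.
  set (e := exp (beta / 2 * L r)) in *; set (e' := exp (- (beta / 2) * L r)) in *.
  (* Multiplying h1 + i h2 = 1 by (1 - r w) ^ beta recovers the two series. *)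
  split.
  - transitivity (e * (C * (e' * (A r * C + B r * S)) - S * (e' * (B r * C - A r * S)))).
    + transitivity (e * e' * A r * (S * S + C * C)); [rewrite Ee, Hsc; ring | ring].
    + rewrite <- E1, <- E2; ring.
  - transitivity (e * (S * (e' * (A r * C + B r * S)) + C * (e' * (B r * C - A r * S)))).
    + transitivity (e * e' * B r * (S * S + C * C)); [rewrite Ee, Hsc; ring | ring].
    + rewrite <- E1, <- E2; ring.
Qed.

(** Let r tend to 1 from the left in [PSeries_binomial]. The closed form is continuous at r = 1
    because w differs from 1, and the series tends to its sum by [filterlim_PSeries_left_1]. *)
Lemma is_series_binomial_circle :
  cos theta < 1 ->
  is_series (fun m => power_coef alpha m * cos (INR m * theta))
    (exp ((1 - alpha) / 2 * ln (2 - 2 * cos theta))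
     * cos ((1 - alpha) * atan (- sin theta / (1 - cos theta)))) /\
  is_series (fun m => power_coef alpha m * sin (INR m * theta))
    (exp ((1 - alpha) / 2 * ln (2 - 2 * cos theta))
     * sin ((1 - alpha) * atan (- sin theta / (1 - cos theta)))).
Proof.
  intros Hc.
  assert (Hlim : forall (u : nat -> R) (g : R -> R),
    ex_series (fun m => Rabs (u m)) ->
    (forall r, 0 < r < 1 -> PSeries u r = g r) -> continuous g 1 ->
    is_series u (g 1)).
  { intros u g Hu Hug Hg.
    replace (g 1) with (Series u); [apply Series_correct, ex_series_Rabs, Hu|].
    apply (filterlim_locally_unique (F := at_left 1) (PSeries u)).
    - apply filterlim_PSeries_left_1, Hu.
    - apply filterlim_ext_loc with g.
      + exists (mkposreal 1 Rlt_0_1); intros r Hr Hr1; symmetry; apply Hug.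
        apply Rabs_lt_between' in Hr; simpl in Hr; lra.
      + exact (filterlim_filter_le_1 (F := locally 1) g
          (filter_le_within (F := locally 1) _) Hg). }
  assert (Hpos : 0 < sqmod 1) by (unfold sqmod; lra).
  replace (2 - 2 * cos theta) with (sqmod 1) by (unfold sqmod; ring).
  replace (- sin theta / (1 - cos theta))
    with (- (1 * sin theta) / (1 - 1 * cos theta)) by (rewrite !Rmult_1_l; reflexivity).
  split.
  - apply (Hlim a (fun r => exp (beta / 2 * ln (sqmod r)) * cos (beta * arg r)) Ha).
    + intros r Hr; apply PSeries_binomial, Hr.
    + apply (ex_derive_continuous
        (fun r => exp (beta / 2 * ln (sqmod r)) * cos (beta * arg r))).
      unfold sqmod, arg in *; auto_derive; lra.
  - apply (Hlim b (fun r => exp (beta / 2 * ln (sqmod r)) * sin (beta * arg r)) Hb).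
    + intros r Hr; apply PSeries_binomial, Hr.
    + apply (ex_derive_continuous
        (fun r => exp (beta / 2 * ln (sqmod r)) * sin (beta * arg r))).
      unfold sqmod, arg in *; auto_derive; lra.
Qed.

End BinomialSeries.

(** * Filtering by roots of unity *)

Lemma sum_below_S (n : nat) (f : nat -> R) :
  sum_below (S n) f = sum_below n f + f n.
Proof.
  unfold sum_below; rewrite seq_S, map_app, fold_right_app; simpl.
  (* The starting value of the fold must be arbitrary before the induction on the list. *)
  generalize (f n + 0) (Rplus_0_r (f n)); intros y <-.
  induction (map f (seq 0 n)) as [|x t IH]; simpl; [|rewrite IH]; ring.
Qed.

Lemma sum_below_ext (n : nat) (f g : nat -> R) :
  (forall j, (j < n)%nat -> f j = g j) -> sum_below n f = sum_below n g.
Proof.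
  induction n as [|n IH]; intros H; [reflexivity|].
  rewrite !sum_below_S, IH, H by auto; reflexivity.
Qed.

Lemma sum_below_scal (c : R) (n : nat) (f : nat -> R) :
  sum_below n (fun j => c * f j) = c * sum_below n f.
Proof.
  induction n as [|n IH]; [unfold sum_below; simpl; ring|].
  rewrite !sum_below_S, IH; ring.
Qed.

Lemma sum_below_single (n q : nat) (f : nat -> R) :
  (q < n)%nat -> (forall i, (i < n)%nat -> i <> q -> f i = 0) -> sum_below n f = f q.
Proof.
  intros Hq; assert (Z : forall m, (forall i, (i < m)%nat -> f i = 0) -> sum_below m f = 0).
  { induction m as [|m IH]; intros H; [reflexivity|].
    rewrite sum_below_S, IH, H by auto; ring. }
  induction n as [|n IH]; intros H; [lia|]; rewrite sum_below_S.
  destruct (Nat.eq_dec q n) as [->|Hne].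
  - rewrite Z; [ring | intros i Hi; apply H; lia].
  - rewrite IH, (H n); [ring | lia | lia | lia | intros i Hi; apply H; lia].
Qed.

Lemma is_series_sum_below (n : nat) (f : nat -> nat -> R) (s : nat -> R) :
  (forall j, (j < n)%nat -> is_series (f j) (s j)) ->
  is_series (fun m => sum_below n (fun j => f j m)) (sum_below n s).
Proof.
  induction n as [|n IH]; intros H.
  (* The zero series is summed as 0 times a geometric series. *)
  - apply (is_series_ext (fun m => scal 0 (0 ^ m))).
    + intros m; unfold sum_below, scal; simpl; unfold mult; simpl; ring.
    + replace (sum_below 0 s) with (scal 0 (/ (1 - 0)))
        by (unfold sum_below, scal; simpl; unfold mult; simpl; ring).
      apply (is_series_scal 0 (fun m => 0 ^ m)), is_series_geom; rewrite Rabs_R0; lra.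
  - apply (is_series_ext (fun m => plus (sum_below n (fun j => f j m)) (f n m))).
    + intros m; rewrite sum_below_S; reflexivity.
    + rewrite sum_below_S; apply (is_series_plus (fun m => sum_below n (fun j => f j m)) (f n));
        auto.
Qed.

Lemma sum_below_mult (l K : nat) (a : nat -> R) :
  sum_below (l * K) a = sum_below K (fun k => sum_below l (fun i => a (l * k + i)%nat)).
Proof.
  induction K as [|K IH]; [rewrite Nat.mul_0_r; reflexivity|].
  rewrite sum_below_S, <- IH, Nat.mul_succ_r; clear IH.
  generalize (l * K)%nat; intros N; induction l as [|l IHl].
  - rewrite Nat.add_0_r; unfold sum_below at 3; simpl; ring.
  - rewrite Nat.add_succ_r, !sum_below_S, IHl; ring.
Qed.

Lemma sum_n_sum_below (a : nat -> R) (m : nat) : sum_n a m = sum_below (S m) a.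
Proof.
  induction m as [|m IH]; [rewrite sum_O; unfold sum_below; simpl; ring|].
  rewrite sum_Sn, IH, (sum_below_S (S m)); reflexivity.
Qed.

Lemma is_series_sum_blocks (l : nat) (a : nat -> R) (s : R) :
  (0 < l)%nat -> is_series a s ->
  is_series (fun k => sum_below l (fun i => a (l * k + i)%nat)) s.
Proof.
  intros Hl Ha.
  apply (filterlim_ext (fun K => sum_n a (l * S K - 1))).
  - intros K; rewrite !sum_n_sum_below, <- sum_below_mult; f_equal; nia.
  - apply (filterlim_comp _ _ _ (fun K => (l * S K - 1)%nat) (sum_n a) _ eventually);
      [|exact Ha].
    intros P [N HN]; exists N; intros K HK; apply HN; nia.
Qed.

(** Each product 2 sin x cos y is sin (y + x) - sin (y - x), and the sum telescopes. For a = K = n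
    this is the Dirichlet kernel; [a] stays apart from [K] so that the induction can vary [K]
    alone. *)
Lemma sin_mult_sum_cos (a x : R) (K : nat) :
  sin x * (2 * sum_below K (fun i => cos (2 * (a - INR i) * x)))
  = sin ((2 * a + 1) * x) - sin ((2 * (a - INR K) + 1) * x).
Proof.
  induction K as [|K IH].
  - simpl; rewrite Rminus_0_r; unfold sum_below; simpl; ring.
  - rewrite sum_below_S, Rmult_plus_distr_l, Rmult_plus_distr_l, IH, S_INR.
    replace ((2 * (a - INR K) + 1) * x) with (2 * (a - INR K) * x + x) by ring.
    replace ((2 * (a - (INR K + 1)) + 1) * x) with (2 * (a - INR K) * x - x) by ring.
    rewrite sin_plus, sin_minus; ring.
Qed.

Lemma sin_INR_mult_PI (m : nat) : sin (INR m * PI) = 0.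
Proof. apply sin_eq_0_1; exists (Z.of_nat m); now rewrite <- INR_IZR_INZ. Qed.

Lemma sin_plus_INR_PI (x : R) (m : nat) : sin (x + INR m * PI) = (-1) ^ m * sin x.
Proof.
  induction m as [|m IH]; [simpl; rewrite Rmult_0_l, Rplus_0_r; ring|].
  rewrite S_INR; replace (x + (INR m + 1) * PI) with (x + INR m * PI + PI) by ring.
  rewrite neg_sin, IH; simpl; ring.
Qed.

Lemma cos_plus_INR_PI (x : R) (m : nat) : cos (x + INR m * PI) = (-1) ^ m * cos x.
Proof.
  induction m as [|m IH]; [simpl; rewrite Rmult_0_l, Rplus_0_r; ring|].
  rewrite S_INR; replace (x + (INR m + 1) * PI) with (x + INR m * PI + PI) by ring.
  rewrite neg_cos, IH; simpl; ring.
Qed.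

Definition half_angle (n j : nat) : R :=
  PI * (2 * INR j + 1) / (2 * (2 * INR n + 1)).

Lemma half_angle_bounds (n j : nat) : (j < n)%nat -> 0 < half_angle n j < PI / 2.
Proof.
  intros Hj; unfold half_angle.
  apply lt_INR in Hj; generalize (pos_INR j) PI_RGT_0; intros.
  split; [apply Rdiv_lt_0_compat; nra|].
  apply Rmult_lt_reg_r with (2 * (2 * INR n + 1)); [lra|].
  replace (PI * (2 * INR j + 1) / (2 * (2 * INR n + 1)) * (2 * (2 * INR n + 1)))
    with (PI * (2 * INR j + 1)) by (field; lra).
  nra.
Qed.

(* The angles [PI - 2 * half_angle n j = 2 * PI * (n - j) / (2 * n + 1)], [j < n],
   represent the nontrivial [2 * n + 1]-st roots of unity up to conjugation. *)
Lemma roots_of_unity_filter (n k q i : nat) :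
  (q < 2 * n + 1)%nat -> (i < 2 * n + 1)%nat ->
  1 + 2 * sum_below n (fun j =>
    cos ((INR ((2 * n + 1) * k + i) - INR q) * (PI - 2 * half_angle n j)))
  = if Nat.eq_dec i q then 2 * INR n + 1 else 0.
Proof.
  intros Hq Hi.
  set (x := (INR i - INR q) * (PI / (2 * INR n + 1))).
  generalize (pos_INR n); intros Hn.
  (* The block index [k] only adds k (n - j) full turns to the angle. *)
  rewrite (sum_below_ext n _ (fun j => cos (2 * (INR n - INR j) * x))).
  2:{ intros j Hj; symmetry; rewrite <- (cos_period _ (k * (n - j))); f_equal.
      unfold x, half_angle.
      rewrite !mult_INR, minus_INR, plus_INR, mult_INR, plus_INR, mult_INR by lia; simpl.
      field; lra. }
  destruct (Nat.eq_dec i q) as [->|Hne].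
  - rewrite (sum_below_ext n _ (fun _ => 1)).
    + assert (E : forall m, sum_below m (fun _ => 1) = INR m).
      { induction m as [|m IH]; [reflexivity|]; now rewrite sum_below_S, IH, S_INR. }
      rewrite E; ring.
    + intros j _; unfold x.
      replace (2 * (INR n - INR j) * ((INR q - INR q) * (PI / (2 * INR n + 1)))) with 0 by ring.
      apply cos_0.
  (* Distinct residues differ by less than 2 n + 1, so 0 < |x| < PI. *)
  - assert (Hx : sin x <> 0).
    { assert (Hs : 0 < Rabs x < PI).
      { unfold x; rewrite Rabs_mult, (Rabs_pos_eq (PI / _));
          [|apply Rlt_le, Rdiv_lt_0_compat; [apply PI_RGT_0 | lra]].
        assert (Hd : 0 < Rabs (INR i - INR q) < 2 * INR n + 1).
        { split; [apply Rabs_pos_lt; intros H; apply Hne, INR_eq; lra|].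
          apply lt_INR in Hq; apply lt_INR in Hi; rewrite plus_INR, mult_INR in Hq, Hi.
          simpl in Hq, Hi; generalize (pos_INR i) (pos_INR q); intros.
          apply Rabs_def1; lra. }
        generalize PI_RGT_0; intros HPI; split.
        - apply Rmult_lt_0_compat; [apply Hd | apply Rdiv_lt_0_compat; lra].
        - apply Rmult_lt_reg_r with (2 * INR n + 1); [lra|].
          replace (Rabs (INR i - INR q) * (PI / (2 * INR n + 1)) * (2 * INR n + 1))
            with (Rabs (INR i - INR q) * PI) by (field; lra).
          nra. }
      generalize (sin_gt_0 (Rabs x) (proj1 Hs) (proj2 Hs)); intros Hp.
      unfold Rabs in Hp; destruct (Rcase_abs x); [rewrite sin_neg in Hp|]; lra. }
    (* Times sin x, the left side collapses to sin ((2 n + 1) x) = sin ((i - q) PI) = 0. *)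
    apply Rmult_eq_reg_l with (sin x); [|exact Hx].
    rewrite Rmult_plus_distr_l, sin_mult_sum_cos, Rmult_0_r.
    replace ((2 * INR n + 1) * x) with (INR i * PI - INR q * PI) by (unfold x; field; lra).
    replace ((2 * (INR n - INR n) + 1) * x) with x by ring.
    rewrite sin_minus, !sin_INR_mult_PI; ring.
Qed.

(* At [theta = PI - 2 x], [1 - exp (i theta) = 2 cos x * exp (- i x)]. *)
Lemma is_series_binomial_half_angle (alpha x : R) (q : nat) :
  0 < alpha < 1 -> 0 < x < PI / 2 ->
  is_series (fun m => power_coef alpha m * cos ((INR m - INR q) * (PI - 2 * x)))
    (Rpower 2 (1 - alpha) * Rpower (cos x) (1 - alpha)
     * ((-1) ^ q * cos ((1 - alpha - 2 * INR q) * x))).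
Proof.
  intros Ha Hx.
  assert (Hc : 0 < cos x) by (apply cos_gt_0; lra).
  assert (Hcos : cos (PI - 2 * x) = 1 - 2 * (cos x * cos x)).
  { unfold Rminus at 1; rewrite Rplus_comm, neg_cos, cos_neg, cos_2a_cos; ring. }
  assert (Hsin : sin (PI - 2 * x) = 2 * sin x * cos x).
  { rewrite <- sin_2a; apply sin_PI_x. }
  destruct (is_series_binomial_circle alpha (PI - 2 * x) Ha) as [HA HB];
    [rewrite Hcos; nra|].
  assert (Hmod : exp ((1 - alpha) / 2 * ln (2 - 2 * cos (PI - 2 * x)))
    = Rpower 2 (1 - alpha) * Rpower (cos x) (1 - alpha)).
  { rewrite Rpower_mult_distr by lra; unfold Rpower; f_equal; rewrite Hcos.
    replace (2 - 2 * (1 - 2 * (cos x * cos x))) with ((2 * cos x) * (2 * cos x)) by ring.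
    rewrite ln_mult by lra; field. }
  assert (Harg : atan (- sin (PI - 2 * x) / (1 - cos (PI - 2 * x))) = - x).
  { rewrite Hsin, Hcos.
    replace (- (2 * sin x * cos x) / (1 - (1 - 2 * (cos x * cos x)))) with (tan (- x))
      by (rewrite tan_neg; unfold tan; field; split; nra).
    apply atan_tan; lra. }
  rewrite Hmod, Harg in HA, HB.
  (* The shift by [q] is a rotation: it combines the cosine and sine series with constant
     weights. *)
  apply (is_series_ext (fun m =>
    plus (scal (cos (INR q * (PI - 2 * x))) (power_coef alpha m * cos (INR m * (PI - 2 * x))))
         (scal (sin (INR q * (PI - 2 * x))) (power_coef alpha m * sin (INR m * (PI - 2 * x)))))).
  - intros m; unfold plus, scal; simpl; unfold mult; simpl.
    rewrite Rmult_minus_distr_r, cos_minus; ring.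
  (* The sign (-1) ^ q is the part q PI of the angle q (PI - 2 x). *)
  - rewrite <- cos_plus_INR_PI.
    replace ((1 - alpha - 2 * INR q) * x + INR q * PI)
      with (INR q * (PI - 2 * x) - (1 - alpha) * - x) by ring.
    rewrite cos_minus.
    match goal with |- is_series _ (?e * (?c1 * ?c2 + ?s1 * ?s2)) =>
      replace (e * (c1 * c2 + s1 * s2)) with (plus (scal c1 (e * c2)) (scal s1 (e * s2)))
        by (unfold plus, scal; simpl; unfold mult; simpl; ring) end.
    apply (is_series_plus
      (fun m => scal (cos (INR q * (PI - 2 * x)))
        (power_coef alpha m * cos (INR m * (PI - 2 * x))))
      (fun m => scal (sin (INR q * (PI - 2 * x)))
        (power_coef alpha m * sin (INR m * (PI - 2 * x))))).
    + exact (is_series_scal (cos (INR q * (PI - 2 * x))) _ _ HA).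
    + exact (is_series_scal (sin (INR q * (PI - 2 * x))) _ _ HB).
Qed.

(** The coefficients are weighted by the sum over all roots of unity, conjugate roots being paired
    into 2 cos. Grouped in blocks of 2 n + 1, the weighted series keeps one term per block, with
    factor 2 n + 1. The root 1 contributes 0, so only the sum over j < n remains. *)
Lemma is_series_power_coef_progression (alpha : R) (n q : nat) :
  0 < alpha < 1 -> (q < 2 * n + 1)%nat ->
  is_series (fun k => power_coef alpha ((2 * n + 1) * k + q))
    (/ (2 * INR n + 1) * (2 * sum_below n (fun j =>
      Rpower 2 (1 - alpha) * Rpower (cos (half_angle n j)) (1 - alpha)
      * ((-1) ^ q * cos ((1 - alpha - 2 * INR q) * half_angle n j))))).
Proof.
  intros Ha Hq; generalize (pos_INR n); intros Hn.
  set (s := fun j => Rpower 2 (1 - alpha) * Rpower (cos (half_angle n j)) (1 - alpha)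
      * ((-1) ^ q * cos ((1 - alpha - 2 * INR q) * half_angle n j))).
  pose (f := fun j m =>
    power_coef alpha m * cos ((INR m - INR q) * (PI - 2 * half_angle n j))).
  assert (H : is_series (fun m => plus (power_coef alpha m)
      (scal 2 (sum_below n (fun j => f j m)))) (plus 0 (scal 2 (sum_below n s)))).
  { apply (is_series_plus (power_coef alpha) (fun m => scal 2 (sum_below n (fun j => f j m)))).
    - apply is_series_power_coef, Ha.
    - apply (is_series_scal 2 (fun m => sum_below n (fun j => f j m))).
      apply is_series_sum_below; intros j Hj.
      apply is_series_binomial_half_angle; [exact Ha | apply half_angle_bounds, Hj]. }
  apply (is_series_sum_blocks (2 * n + 1)) in H; [|lia].
  apply (is_series_scal (/ (2 * INR n + 1))) in H.
  replace (/ (2 * INR n + 1) * (2 * sum_below n s))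
    with (scal (/ (2 * INR n + 1)) (plus 0 (scal 2 (sum_below n s))))
    by (unfold plus, scal; simpl; unfold mult; simpl; ring).
  eapply is_series_ext; [|exact H].
  intros k; unfold plus, scal; simpl; unfold mult; simpl.
  rewrite (sum_below_ext (2 * n + 1) _ (fun i => power_coef alpha ((2 * n + 1) * k + i)
    * (if Nat.eq_dec i q then 2 * INR n + 1 else 0))).
  - rewrite (sum_below_single _ q); [|exact Hq|].
    + destruct (Nat.eq_dec q q); [|congruence].
      change (n + (n + 0) + 1)%nat with (2 * n + 1)%nat; field; lra.
    + intros i _ Hi; destruct (Nat.eq_dec i q); [congruence | ring].
  - intros i Hi; rewrite <- (roots_of_unity_filter n k q i Hq Hi).
    unfold f; rewrite sum_below_scal; change (n + (n + 0))%nat with (2 * n)%nat; ring.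
Qed.

(** * The closed form of the coefficients *)

Theorem mainTheorem2 (alpha : R) (n p : nat)
  (halpha : 0 < alpha < 1) (hp : (1 <= p <= 2 * n + 1)%nat) :
  ex_series (S_term alpha p (2 * n + 1)) /\
  S_coef alpha p (2 * n + 1) =
    Rpower 2 (2 - alpha) * Gamma alpha / (2 * INR n + 1) * (-1) ^ p *
    sum_below n (fun j =>
      (-1) ^ j *
      Rpower (cos (PI * (2 * INR j + 1) / (2 * (2 * INR n + 1)))) (1 - alpha) *
      sin (PI * (2 * INR j + 1) * (2 * INR p + 2 * INR n - 2 + alpha)
           / (2 * (2 * INR n + 1)))).
Proof.
  (* The residue to be filtered is q = p - 1. *)
  destruct p as [|q]; [lia|].
  assert (Hq : (q < 2 * n + 1)%nat) by lia.
  generalize (is_series_power_coef_progression alpha n q halpha Hq); intros H.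
  apply (is_series_scal (- Gamma alpha)) in H.
  assert (HS : is_series (S_term alpha (S q) (2 * n + 1))
    (- Gamma alpha * (/ (2 * INR n + 1) * (2 * sum_below n (fun j =>
      Rpower 2 (1 - alpha) * Rpower (cos (half_angle n j)) (1 - alpha)
      * ((-1) ^ q * cos ((1 - alpha - 2 * INR q) * half_angle n j))))))).
  { eapply is_series_ext; [|exact H].
    intros k; rewrite S_term_power_coef by (exact halpha || lia).
    replace (S q - 1)%nat with q by lia; reflexivity. }
  split; [eexists; exact HS|].
  unfold S_coef; rewrite (is_series_unique _ _ HS).
  rewrite (sum_below_ext n _ (fun j => Rpower 2 (1 - alpha) * (-1) ^ q * ((-1) ^ j *
      Rpower (cos (PI * (2 * INR j + 1) / (2 * (2 * INR n + 1)))) (1 - alpha) *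
      sin (PI * (2 * INR j + 1) * (2 * INR (S q) + 2 * INR n - 2 + alpha)
           / (2 * (2 * INR n + 1)))))).
  - rewrite sum_below_scal.
    (* The factor 2 from pairing conjugate roots raises the power of 2, and - (-1) ^ q is (-1) ^
       p. *)
    replace (2 - alpha) with (1 + (1 - alpha)) by ring.
    rewrite Rpower_plus, Rpower_1 by lra; simpl pow.
    generalize (pos_INR n); intros; field; lra.
  - intros j _; generalize (pos_INR n); intros Hn; fold (half_angle n j).
    (* With x = [half_angle n j], the angle is (2 q + 2 n + alpha) x, and (2 n + 1) x = PI / 2 + j
       PI turns the cosine into a sine with sign (-1) ^ j. *)
    replace (PI * (2 * INR j + 1) * (2 * INR (S q) + 2 * INR n - 2 + alpha)
             / (2 * (2 * INR n + 1)))
      with (PI / 2 + - ((1 - alpha - 2 * INR q) * half_angle n j) + INR j * PI)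
      by (rewrite S_INR; unfold half_angle; field; lra).
    rewrite sin_plus_INR_PI, <- cos_sin, cos_neg.
    transitivity (((-1) ^ j * (-1) ^ j) * (Rpower 2 (1 - alpha)
      * Rpower (cos (half_angle n j)) (1 - alpha)
      * ((-1) ^ q * cos ((1 - alpha - 2 * INR q) * half_angle n j)))); [|ring].
    rewrite <- Rpow_mult_distr; replace (-1 * -1) with 1 by ring; rewrite pow1; ring.
Qed.
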